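(* For any integers $n\ge 2$, $a\ge 2$ and $r\ge 1$, the hypertetrahedral arrangement $\mathcal{A}_{a,n}^r$ in $\mathbb{P}^n$ with defining equation $$x_0x_1\cdots x_n\prod_{0\le i<j\le n}(x_i^a-x_j^a)\; g_{(r-1)a}(x_{n-1},x_n),$$ where $g_{(r-1)a}(x_{n-1},x_n)\in \Bbbk[x_{n-1},x_n]$ is a general homogeneous polynomial of degree $(r-1)a$, is free with exponents $(1,2a+1,\dots,na+1,ra+1)$ (that is, $1$, $ia+1$ for $2\le i\le n$, and $ra+1$).
   Context: $\Bbbk$ is an algebraically closed field of characteristic $0$, $R=\Bbbk[x_0,\dots,x_n]$, $\mathbb{P}^n=\mathrm{Proj}(R)$. ''General'' means: for all polynomials in some nonempty Zariski open subset of the space of homogeneous polynomials of degree $(r-1)a$ in $x_{n-1},x_n$ (in particular the displayed equation is a product of pairwise non-proportional linear forms, each factor of $g_{(r-1)a}$ being a linear form in $x_{n-1},x_n$). For a hyperplane arrangement $\mathcal{A}$ with defining equation $f_{\mathcal{A}}$ (the product of linear forms defining its hyperplanes), $\mathrm{Der}(-\log\mathcal{A})=\{\theta\in \mathrm{Der}_{\Bbbk}(R): \theta(f_{\mathcal{A}})\in (f_{\mathcal{A}})\}$; a derivation $\theta=\sum_i\theta_i\partial_{x_i}$ has degree $d$ if all $\theta_i\in R_d$. $\mathcal{A}$ is free if $\mathrm{Der}(-\log\mathcal{A})$ is a free $R$-module of rank $n+1$; the degrees $1,d_1,\dots,d_n$ of a homogeneous basis $\theta_E=\sum_i x_i\partial_{x_i},\theta_1,\dots,\theta_n$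 are its exponents (order is irrelevant). *)

(* Defs.v *)
From HB Require Import structures.
From mathcomp Require Import all_boot all_order all_algebra.
From mathcomp Require Import mpoly.

Set Implicit Arguments.
Unset Strict Implicit.
Unset Printing Implicit Defensive.

Import GRing.Theory.
Local Open Scope ring_scope.

(* [U] is the complement of the common zero locus of the polynomials in [S]. *)
Definition zariski_open (k : fieldType) (N : nat) (U : ('I_N -> k) -> Prop) :
    Prop :=
  exists S : {mpoly k[N]} -> Prop,
    forall v, U v <-> exists p, S p /\ p.@[v] != 0.

Definition for_general (k : fieldType) (N : nat) (P : ('I_N -> k) -> Prop) :
    Prop :=
  exists U : ('I_N -> k) -> Prop,
    [/\ zariski_open U, exists v, U v & forall v, U v -> P v].

(* In the pairwise condition [c] may be 0: this is harmless, since all forms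
   are nonzero. *)
Record arrangement (k : fieldType) (m : nat) := Arrangement {
  forms :> seq {mpoly k[m]};
  forms_linear : forall l, l \in forms -> l != 0 /\ l \is 1.-homog;
  forms_nonprop : forall i j : nat, (i < j < size forms)%N ->
    forall c : k, forms`_i != c *: forms`_j
}.

Definition defining_equation (k : fieldType) (m : nat)
    (A : arrangement k m) : {mpoly k[m]} :=
  \prod_(l <- forms A) l.

Definition is_derivation (k : fieldType) (m : nat)
    (theta : {mpoly k[m]} -> {mpoly k[m]}) : Prop :=
  linear theta /\
  forall f g, theta (f * g) = theta f * g + f * theta g.

(* The coefficients of [theta = \sum_i theta_i d/dx_i] are
   [theta_i = theta x_i]. *)
Definition der_homog (k : fieldType) (m d : nat)
    (theta : {mpoly k[m]} -> {mpoly k[m]}) : Prop :=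
  forall i : 'I_m, theta 'X_i \is d.-homog.

Definition euler (k : fieldType) (m : nat) (f : {mpoly k[m]}) : {mpoly k[m]} :=
  \sum_(i < m) 'X_i * f^`M(i).

Definition der_log (k : fieldType) (m : nat) (A : arrangement k m)
    (theta : {mpoly k[m]} -> {mpoly k[m]}) : Prop :=
  is_derivation theta /\
  exists q, theta (defining_equation A) = q * defining_equation A.

(* [theta] is a basis of the [{mpoly k[m]}]-module [der_log A]. *)
Definition der_log_basis (k : fieldType) (m s : nat) (A : arrangement k m)
    (theta : 'I_s -> {mpoly k[m]} -> {mpoly k[m]}) : Prop :=
  [/\ forall i, der_log A (theta i),
      forall eta, der_log A eta ->
        exists c : 'I_s -> {mpoly k[m]},
          forall f, eta f = \sum_(i < s) c i * theta i f
    & forall c : 'I_s -> {mpoly k[m]},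
        (forall f, \sum_(i < s) c i * theta i f = 0) -> forall i, c i = 0].

Definition is_free (k : fieldType) (m : nat) (A : arrangement k m) : Prop :=
  exists theta : 'I_m -> {mpoly k[m]} -> {mpoly k[m]}, der_log_basis A theta.

(* Exponents are a multiset, whence [perm_eq]; a homogeneous derivation in a
   basis is nonzero, so its degree is well defined. *)
Definition has_exponents (k : fieldType) (n : nat) (A : arrangement k n.+1)
    (e : seq nat) : Prop :=
  exists (theta : 'I_n.+1 -> {mpoly k[n.+1]} -> {mpoly k[n.+1]})
         (deg : 'I_n.+1 -> nat),
    [/\ der_log_basis A theta,
        theta ord0 =1 @euler k n.+1,
        forall i, der_homog (deg i) (theta i)
      & perm_eq [seq deg i | i <- enum 'I_n.+1] e].

(* The form of degree [d] in x_{n-1}, x_n with coefficient vector [v]; the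
   coefficients are the coordinates on the affine space of all such forms. *)
Definition binary_form (k : fieldType) (n d : nat) (v : 'I_d.+1 -> k) :
    {mpoly k[n.+1]} :=
  \sum_(i < d.+1) v i *: ('X_(inord n.-1) ^+ i * 'X_ord_max ^+ (d - i)).

Definition hypertetrahedral_eq (k : fieldType) (n a : nat)
    (g : {mpoly k[n.+1]}) : {mpoly k[n.+1]} :=
  (\prod_(i < n.+1) 'X_i)
  * (\prod_(i < n.+1) \prod_(j < n.+1 | (i < j)%N) ('X_i ^+ a - 'X_j ^+ a))
  * g.

(* Main.v *)
Require Import Defs.
From HB Require Import structures.
From mathcomp Require Import all_boot all_order all_algebra all_field.
From mathcomp Require Import mpoly ring zify.

Set Implicit Arguments.
Unset Strict Implicit.
Unset Printing Implicit Defensive.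

Import GRing.Theory.
Local Open Scope ring_scope.

(** Write y_i = x_i^a. Every hyperplane is x_i = 0 or x_i = c x_j with c <> 0,
    so a derivation is logarithmic iff it has the form sum_i x_i h_i d_i with
    h_i = h_j on each hyperplane x_i = c x_j. Such vectors h are expanded by
    Newton interpolation at the nodes y_n, y_(n-1), ..., y_0, in the family
    h^s_i = (y_i - y_n) ... (y_i - y_(n-s+1)) for 0 <= s <= n, where h^1 is
    multiplied by the binary form g. This family is triangular, and its pivot
    h^s_(n-s) is exactly the product of the forms x_(n-s) - c x_l with
    n - s < l, which must divide h_(n-s) once h_l = 0 for all l > n - s. *)

(** * Discriminants and separability of the general binary form *)

(** Nonzero images of the leading coefficients keep both sizes, so the Sylvester matrix is mapped
    entry by entry. *)
Lemma rmorph_resultant (aR rR : comNzRingType) (f : {rmorphism aR -> rR})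
    (p q : {poly aR}) :
    f (lead_coef p) != 0 -> f (lead_coef q) != 0 ->
  f (resultant p q) = resultant (map_poly f p) (map_poly f q).
Proof.
move=> nz_fp nz_fq; rewrite /resultant /Sylvester_mx !size_map_poly_id0 //.
rewrite -det_map_mx /= map_col_mx; congr (\det (col_mx _ _));
  by apply: map_lin1_mx => v; rewrite map_poly_rV rmorphM /= map_rVpoly.
Qed.

(** For nonconstant [p] in characteristic 0 the degree is a nonzero factor, so differentiation
    lowers the size by exactly one. *)
Lemma lead_coef_deriv (R : idomainType) (p : {poly R}) :
  [pchar R] =i pred0 -> lead_coef p^`() = lead_coef p *+ (size p).-1.
Proof.
move=> /pcharf0P R0; have [sz_p | sz_p] := leqP (size p) 1.
  by rewrite (size1_polyC sz_p) derivC lead_coef0 size_polyC; case: eqP.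
have p0 : p != 0 by rewrite -size_poly_gt0 (ltn_trans _ sz_p).
have dE : p^`()`_(size p).-2 = lead_coef p *+ (size p).-1.
  by rewrite coef_deriv lead_coefE; case: (size p) sz_p => [|[]].
have dN0 : p^`()`_(size p).-2 != 0.
  rewrite dE -mulr_natr mulf_neq0 ?lead_coef_eq0 // R0.
  by case: (size p) sz_p => [|[]].
have sz_d : size p^`() = (size p).-1.
  apply/eqP; rewrite eqn_leq; apply/andP; split.
    by have := lt_size_deriv p0; case: (size p) sz_p.
  have := contraNltn _ dN0; case: (size p) sz_p => [|[|s]] //= _; apply.
  by move=> sz_le; rewrite nth_default.
by rewrite lead_coefE sz_d dE.
Qed.

Section GenericPolynomial.

Variables (k : fieldType) (d : nat) (B : {poly k}).
Hypothesis k0 : [pchar k] =i pred0.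
Hypothesis monicB : B \is monic.

(** The binary form with coefficients [v] at x_(n-1) = T, x_n = 1. *)
Definition dehomog (v : 'I_d.+1 -> k) : {poly k} :=
  \poly_(i < d.+1) v (inord i).

Definition generic_dehomog : {poly {mpoly k[d.+1]}} :=
  \poly_(i < d.+1) 'X_(inord i).

Local Notation Q := (map_poly (@mpolyC d.+1 k) B * generic_dehomog).
(* The zero locus of disc contains all v for which B * dehomog v is inseparable
   or drops degree. *)
Local Notation disc := ('X_ord_max * resultant Q Q^`()).

Lemma lead_coef_generic : lead_coef generic_dehomog = 'X_ord_max.
Proof.
rewrite lead_coef_poly //=.
  by congr 'X_(_); apply: val_inj; rewrite /= inordK.
by rewrite -msize_poly_eq0 mmeasureX.
Qed.

Lemma map_meval_generic v : map_poly (meval v) Q = B * dehomog v.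
Proof.
rewrite rmorphM /= -map_poly_comp; congr (_ * _).
  by rewrite map_poly_id // => c _ /=; rewrite mevalC.
apply/polyP => i; rewrite coef_map /= !coef_poly.
by case: ifP => _; rewrite ?meval0 // mevalXU.
Qed.

(** As [v ord_max] is nonzero, no degree drops under evaluation and the resultant specialises; it
    vanishes iff the polynomial and its derivative have a common factor. *)
Lemma meval_disc v : (1 < size B)%N -> v ord_max != 0 ->
  (disc.@[v] != 0) = separable_poly (B * dehomog v).
Proof.
move=> B1 vN0; rewrite mevalM mevalXU mulf_eq0 (negPf vN0) /=.
have M0 : [pchar {mpoly k[d.+1]}] =i pred0.
  apply/pcharf0P => i; rewrite -mpolyC_nat mpolyC_eq0.
  by have /pcharf0P -> := k0.
have szB : size (map_poly (@mpolyC d.+1 k) B) = size B.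
  by rewrite size_map_inj_poly ?mpolyC0 //; apply: can_inj (@mpolyCK _ _).
have lcB : lead_coef (map_poly (@mpolyC d.+1 k) B) = 1.
  rewrite lead_coef_map_inj ?mpolyC0 ?(monicP monicB) ?mpolyC1 //.
  exact: can_inj (@mpolyCK _ _).
have lcQ : lead_coef Q = 'X_ord_max.
  by rewrite lead_coefM lcB lead_coef_generic mul1r.
have P0 : generic_dehomog != 0.
  by rewrite -lead_coef_eq0 lead_coef_generic -msize_poly_eq0 mmeasureX.
have szQ : (1 < size Q)%N.
  rewrite size_mul ?szB //; last by rewrite -size_poly_gt0 szB ltnW.
  by rewrite -subn1 ltn_subRL (leq_add B1) // size_poly_gt0.
have lcQv : (lead_coef Q).@[v] != 0 by rewrite lcQ mevalXU.
have Qv0 : B * dehomog v != 0.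
  by rewrite -map_meval_generic -size_poly_gt0 size_map_poly_id0 // ltnW.
rewrite rmorph_resultant //=.
  rewrite -deriv_map map_meval_generic resultant_eq0 unlock coprimep_def.
  (* The gcd is nonzero by [Qv0], so size at most 1 means size exactly 1. *)
  rewrite -leqNgt leq_eqVlt ltnS leqn0 size_poly_eq0 gcdp_eq0 (negPf Qv0).
  by rewrite orbF.
- rewrite lead_coef_deriv // lcQ mevalMn mevalXU -mulr_natr mulf_neq0 //.
  have /pcharf0P -> := k0.
  by case: (size Q) szQ => [|[]].
Qed.

(** The nonvanishing locus of [disc] is open, and a single separable example shows that it is
    nonempty. *)
Lemma for_general_separable : (1 < size B)%N ->
    (exists v, v ord_max != 0 /\ separable_poly (B * dehomog v)) ->
  for_general (fun v : 'I_d.+1 -> k =>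
    v ord_max != 0 /\ separable_poly (B * dehomog v)).
Proof.
move=> B1 [v [v0 sep_v]]; exists (fun v => disc.@[v] != 0); split.
- exists (eq disc) => w; split=> [Dw | [p [<- //]]].
  by exists disc.
- by exists v; rewrite meval_disc.
- move=> w Dw; have w0 : w ord_max != 0.
    by apply: contraNneq Dw => w0; rewrite mevalM mevalXU w0 mul0r.
  by rewrite -meval_disc.
Qed.

End GenericPolynomial.

(** * Splitting binary forms into linear factors *)

(** Multiplying by T - c shifts the coefficients, which matches a factor x, and subtracts c times
    them, which matches a factor y. It serves both for g and for x^a - y^a. *)
Lemma homogenize_prod_XsubC (k : fieldType) (A : comAlgType k) (x y : A)
    (s : seq k) :
  \sum_(i < (size s).+1)
      (\prod_(c <- s) ('X - c%:P))`_i *: (x ^+ i * y ^+ (size s - i))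
    = \prod_(c <- s) (x - c *: y).
Proof.
elim: s => [|c s IHs]; first by rewrite big_ord1 !big_nil coef1 scale1r mulr1.
rewrite !big_cons -IHs [RHS]mulrBl; set p := \prod_(_ <- s) _.
under eq_bigr do rewrite mulrBl coefB coefXM coefCM scalerBl.
rewrite sumrB; congr (_ - _).
  rewrite big_ord_recl /= scale0r add0r mulr_sumr; apply: eq_bigr => i _.
  by rewrite -scalerAr exprS mulrA.
(* The last index is [(size s).+1], past the top coefficient of [p], so the default 0 is read. *)
rewrite big_ord_recr /= [p`__]nth_default ?size_prod_XsubC //.
rewrite mulr0 scale0r addr0.
rewrite mulr_sumr; apply: eq_bigr => i _.
rewrite subSn; last by rewrite -ltnS.
rewrite exprS -scalerAl -scalerAr scalerA; congr (_ *: _); ring.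
Qed.

(** The nonzero top coefficient makes the degree exactly [d], and [k] is algebraically closed. *)
Lemma prod_XsubC_dehomog (k : closedFieldType) (d : nat) (v : 'I_d.+1 -> k) :
  v ord_max != 0 ->
  exists2 s : seq k, size s = d &
    dehomog v = v ord_max *: \prod_(c <- s) ('X - c%:P).
Proof.
move=> v0; have [s sE] := closed_field_poly_normal (dehomog v).
have vE : v (inord d) = v ord_max.
  by congr v; apply: val_inj; rewrite /= inordK.
have lcE : lead_coef (dehomog v) = v ord_max by rewrite lead_coef_poly ?vE.
exists s; last by rewrite -lcE.
have := congr1 (size : {poly k} -> nat) sE.
by rewrite lcE size_scale // size_prod_XsubC size_poly_eq ?vE // => -[].
Qed.

Lemma binary_form_prod (k : fieldType) (n d : nat) (v : 'I_d.+1 -> k)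
    (s : seq k) :
    size s = d -> dehomog v = v ord_max *: \prod_(c <- s) ('X - c%:P) ->
  binary_form n v =
    v ord_max *: \prod_(c <- s) ('X_(inord n.-1) - c *: 'X_ord_max).
Proof.
move=> sz_s vE; rewrite -homogenize_prod_XsubC scaler_sumr /binary_form sz_s.
apply: eq_bigr => i _; rewrite scalerA; congr (_ *: _).
by rewrite -coefZ -vE coef_poly ltn_ord inord_val.
Qed.

(* The witness is the product of the T - i for 2 <= i <= d + 1. *)
Lemma for_general_splits (k : closedFieldType) (a d : nat) :
    [pchar k] =i pred0 -> (0 < a)%N ->
  for_general (fun v : 'I_d.+1 -> k => exists zs cs : seq k,
    [/\ v ord_max != 0,
        size zs = a /\ 'X^a - 1 = \prod_(c <- zs) ('X - c%:P),
        size cs = d,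
        dehomog v = v ord_max *: \prod_(c <- cs) ('X - c%:P)
      & uniq (0 :: zs ++ cs)]).
Proof.
move=> k0 a0; have /pcharf0P natr_k0 := k0.
have [zs zsE] := closed_field_poly_normal ('X^a - 1 : {poly k}).
rewrite lead_coefXnsubC // scale1r in zsE.
have sz_zs : size zs = a.
  by have := congr1 (size : {poly k} -> nat) zsE;
     rewrite size_prod_XsubC size_XnsubC // => -[].
(* The roots of [B] are the slopes of x_(n-1) = 0 and of the factors of x_(n-1)^a - x_n^a.
   Separability of [B * dehomog v] thus makes the factors of g distinct from each other and from
   these. *)
pose B : {poly k} := 'X * ('X^a - 1).
have BE : B = \prod_(c <- 0 :: zs) ('X - c%:P) by rewrite big_cons subr0 -zsE.
have monicB : B \is monic by rewrite BE monic_prod_XsubC.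
have szB : (1 < size B)%N by rewrite BE size_prod_XsubC.
have sepE cs b : b != 0 ->
    separable_poly (B * (b *: \prod_(c <- cs) ('X - c%:P))) = uniq (0 :: zs ++ cs).
  move=> b0; rewrite -[RHS]separable_prod_XsubC -scalerAr BE -big_cat.
  by rewrite (eqp_separable (eqp_scale _ b0)).
have [|U [Uo U0 UP]] := @for_general_separable k d B k0 monicB szB.
  pose cs := [seq i%:R : k | i <- iota 2 d].
  pose p := \prod_(c <- cs) ('X - c%:P).
  have sz_p : size p = d.+1 by rewrite size_prod_XsubC size_map size_iota.
  have pE : dehomog (fun i : 'I_d.+1 => p`_i) = p.
    apply/polyP => i; rewrite coef_poly; case: ltnP => [lt_i|le_i].
      by rewrite inordK.
    by rewrite nth_default ?sz_p.
  have lc_p : p`_d = 1 by have := monic_prod_XsubC cs xpredT id => /monicP;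
     rewrite lead_coefE sz_p.
  exists (fun i : 'I_d.+1 => p`_i); rewrite pE /= lc_p oner_neq0; split => //.
  rewrite -[p]scale1r sepE ?oner_neq0 //.
  have inj_nat : injective (fun i : nat => i%:R : k).
    move=> i j; wlog le_ij : i j / (i <= j)%N => [W ij|/= ij].
      by case: (leqP i j) => [|/ltnW] /W; [exact|move/(_ (esym ij))].
    apply/eqP; rewrite eqn_leq le_ij -subn_eq0 -natr_k0 natrB // ij subrr.
    by rewrite eqxx.
  rewrite -cat_cons cat_uniq -separable_prod_XsubC -BE.
  rewrite map_inj_uniq ?iota_uniq // andbT.
  apply/andP; split.
    rewrite separable_mul separable_Xn_sub_1 ?natr_k0 -?lt0n //.
    rewrite -[X in separable_poly X]subr0.
    have := separable_prod_XsubC [:: 0 : k]; rewrite big_seq1 => -> /=.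
    rewrite -[X in coprimep X _]subr0 coprimep_sym coprimep_XsubC.
    by rewrite /root !hornerE expr0n eqn0Ngt a0 sub0r oppr_eq0 oner_neq0.
  (* In characteristic 0 an integer i >= 2 is no root of T (T^a - 1), since i^a differs from 1. *)
  apply/hasPn => c /mapP[i]; rewrite mem_iota => /andP[i2 _] ->.
  rewrite -root_prod_XsubC -BE rootM negb_or /root !hornerE natr_k0.
  rewrite -lt0n (ltn_trans _ i2) //= subr_eq0 -natrX.
  apply: contraTneq i2 => /(inj_nat _ 1%N)/eqP.
  rewrite -[X in _ == X](exp1n a) eqn_exp2r ?leq_ltn_trans //.
  by move=> /eqP ->.
exists U; split=> // v /UP[v0 sep_v].
have [cs sz_cs vE] := prod_XsubC_dehomog v0.
by exists zs, cs; split => //; rewrite -(sepE cs _ v0) -vE.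
Qed.

(** * Induction on polynomials and first facts on derivations *)

Lemma mpoly_ring_ind (k : fieldType) (m : nat) (P : {mpoly k[m]} -> Prop) :
    (forall c, P c%:MP) -> (forall i, P 'X_i) ->
    (forall p q, P p -> P q -> P (p + q)) ->
    (forall p q, P p -> P q -> P (p * q)) ->
  forall p, P p.
Proof.
move=> PC PX PD PM; elim/mpolyind => [|c u p _ _ Pp].
  by rewrite -mpolyC0.
apply: (PD) => //; rewrite -mul_mpolyC; apply: (PM) => //.
have P1 : P 1 by rewrite -mpolyC1.
rewrite mpolyXE_id; apply: (big_ind P P1 PM) => i _.
by elim: (u i) => [|e IHe]; rewrite ?expr0 // exprS; apply: PM.
Qed.

Lemma derivation0 (k : fieldType) (m : nat)
    (theta : {mpoly k[m]} -> {mpoly k[m]}) :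
  is_derivation theta -> theta 0 = 0.
Proof. by move=> [_ leib]; have := leib 0 0; rewrite !mulr0 mul0r addr0. Qed.

Lemma derivation1 (k : fieldType) (m : nat)
    (theta : {mpoly k[m]} -> {mpoly k[m]}) :
  is_derivation theta -> theta 1 = 0.
Proof.
move=> [_ leib]; have := leib 1 1.
by rewrite !mulr1 mul1r -[LHS]addr0 => /addrI.
Qed.

(** * Linear forms and restriction to their hyperplanes *)

Section LinearForms.

Variables (k : fieldType) (m : nat).
Local Notation R := {mpoly k[m]}.

(* The coordinate form x_i is encoded by the triple (i, i, 0). *)
Definition form_of (t : 'I_m * 'I_m * k) : R := 'X_t.1.1 - t.2 *: 'X_t.1.2.

(** A normal form in which distinct triples give distinct hyperplanes. *)
Definition valid (t : 'I_m * 'I_m * k) : bool :=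
  if t.1.1 == t.1.2 then t.2 == 0 else (t.1.1 < t.1.2)%N && (t.2 != 0).

(** Reduction modulo [form_of t], realised by substitution inside the same ring, so that congruences
    become equations in an integral domain. *)
Definition restrict (t : 'I_m * 'I_m * k) : R -> R :=
  comp_mpoly [tuple if i == t.1.1 then t.2 *: 'X_t.1.2 else 'X_i | i < m].

HB.instance Definition _ t := GRing.RMorphism.copy (restrict t)
  (comp_mpoly [tuple if i == t.1.1 then t.2 *: 'X_t.1.2 else 'X_i | i < m]).

Lemma restrictX t i :
  restrict t 'X_i = if i == t.1.1 then t.2 *: 'X_t.1.2 else 'X_i.
Proof. by rewrite /restrict comp_mpolyXU -tnth_nth tnth_mktuple. Qed.

Lemma restrictZ t c p : restrict t (c *: p) = c *: restrict t p.
Proof. exact: comp_mpolyZ. Qed.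

Lemma restrictB t p q : restrict t (p - q) = restrict t p - restrict t q.
Proof. exact: rmorphB. Qed.

Lemma restrictM t p q : restrict t (p * q) = restrict t p * restrict t q.
Proof. exact: rmorphM. Qed.

Lemma restrict_sum t (T : Type) (r : seq T) (P : pred T) (F : T -> R) :
  restrict t (\sum_(i <- r | P i) F i) = \sum_(i <- r | P i) restrict t (F i).
Proof. exact: rmorph_sum. Qed.

Lemma restrict_prod t (T : Type) (r : seq T) (P : pred T) (F : T -> R) :
  restrict t (\prod_(i <- r | P i) F i) = \prod_(i <- r | P i) restrict t (F i).
Proof. exact: rmorph_prod. Qed.

Lemma restrict_form t : valid t -> restrict t (form_of t) = 0.
Proof.
case: t => [[i j] c]; rewrite /valid /form_of rmorphB /= restrictZ !restrictX /=.
rewrite eqxx; case: (eqVneq i j) => [_|ne_ij].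
  by move=> /eqP ->; rewrite !scale0r subrr.
by rewrite subrr.
Qed.

(** The substitution is the identity modulo the form: this holds on the variables and passes to sums
    and products. *)
Lemma form_of_divides t p : exists q, p - restrict t p = q * form_of t.
Proof.
elim/mpoly_ring_ind: p => [c|i|p q [u pE] [v qE]|p q [u pE] [v qE]].
- by exists 0; rewrite mul0r /restrict comp_mpolyC subrr.
- rewrite restrictX; case: eqP => [->|_]; first by exists 1; rewrite mul1r.
  by exists 0; rewrite mul0r subrr.
- by exists (u + v); rewrite rmorphD mulrDl -pE -qE /=; ring.
- exists (u * q + restrict t p * v).
  rewrite rmorphM mulrDl /= mulrAC -pE -mulrA -qE; ring.
Qed.

Lemma restrict_eq0P t p : valid t ->
  restrict t p = 0 <-> exists q, p = q * form_of t.
Proof.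
move=> t_valid; split=> [p0 | [q ->]].
  by have [q] := form_of_divides t p; rewrite p0 subr0; exists q.
by rewrite rmorphM /= restrict_form // mulr0.
Qed.

(** Divisibility puts the first hyperplane inside the second. Indicator points then locate the
    indices. *)
Lemma restrict_form_inj t u :
  valid t -> valid u -> restrict t (form_of u) = 0 -> t = u.
Proof.
move=> t_valid u_valid /(restrict_eq0P _ t_valid)[q qE].
(* Two forms are compared at a point where the first one vanishes. *)
have vanish (e : 'I_m -> k) :
    e t.1.1 = t.2 * e t.1.2 -> e u.1.1 = u.2 * e u.1.2.
  move=> te; apply/eqP; rewrite -subr_eq0.
  have := congr1 (meval e) qE.
  by rewrite mevalM /form_of !mevalB !mevalZ !mevalXU te subrr mulr0 => ->.
case: t u t_valid u_valid vanish {qE q} => [[i j] c] [[s t] w].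
rewrite /valid /=.
case: (eqVneq i j) => [<- /eqP ->|ne_ij /andP[lt_ij c0]].
  case: (eqVneq s t) => [<- /eqP ->|ne_st /andP[lt_st w0]] van.
    have [->//|ne_is] := eqVneq i s.
    have := van (fun l => (l == s)%:R); rewrite (negPf ne_is) eqxx !mul0r.
    by move=> /(_ erefl)/eqP; rewrite oner_eq0.
  have [eq_si|ne_si] := eqVneq s i; last first.
    have := van (fun l => (l == s)%:R).
    rewrite eq_sym (negPf ne_si) eqxx [t == s]eq_sym (negPf ne_st) mulr0 mulr0.
    by move=> /(_ erefl)/eqP; rewrite oner_eq0.
  have := van (fun l => (l == t)%:R).
  rewrite -eq_si (negPf ne_st) eqxx mulr0 mulr1 => /(_ erefl)/esym/eqP.
  by rewrite (negPf w0).
case: (eqVneq s t) => [<- /eqP ->|ne_st /andP[lt_st w0]] van.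
  have := van (fun l => if l == i then c else 1).
  rewrite eqxx eq_sym (negPf ne_ij) mulr1 mul0r => /(_ erefl)/eqP.
  by case: ifP => _; rewrite ?(negPf c0) ?oner_eq0.
have s_ij : s \in [:: i; j].
  apply: contraT; rewrite !inE negb_or => /andP[si sj].
  have := van (fun l => (l == s)%:R).
  rewrite [i == s]eq_sym [j == s]eq_sym [t == s]eq_sym.
  rewrite (negPf si) (negPf sj) (negPf ne_st) eqxx !mulr0.
  by move=> /(_ erefl)/eqP; rewrite oner_eq0.
have t_ij : t \in [:: i; j].
  apply: contraT; rewrite !inE negb_or => /andP[ti tj].
  have := van (fun l => (l == t)%:R).
  rewrite [i == t]eq_sym [j == t]eq_sym (negPf ti) (negPf tj) (negPf ne_st).
  by rewrite eqxx mulr0 mulr1 => /(_ erefl)/esym/eqP; rewrite (negPf w0).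
have [eq_si eq_tj] : s = i /\ t = j.
  move: s_ij t_ij lt_st ne_st; rewrite !inE.
  move=> /orP[]/eqP-> /orP[]/eqP->; rewrite ?eqxx //.
  by move=> lt_ji; move: lt_ij; rewrite ltnNge ltnW.
rewrite {}eq_si {}eq_tj in van *.
(* This point lies on x_i = c x_j, and its other coordinates 1 turn the second equation into c =
   w. *)
have := van (fun l => if l == i then c else 1).
by rewrite eqxx eq_sym (negPf ne_ij) !mulr1 => /(_ erefl) ->.
Qed.

Lemma form_of_neq0 t : valid t -> form_of t != 0.
Proof.
case: t => [[i j] c]; rewrite /valid /form_of /= => t_valid.
apply/eqP => /(congr1 (meval (fun l => (l == i)%:R))).
rewrite mevalB mevalZ !mevalXU meval0 eqxx; move: t_valid.
rewrite [j == i]eq_sym; case: eqP => _; last first.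
  by rewrite mulr0 subr0 => _ /eqP; rewrite oner_eq0.
by move=> /eqP ->; rewrite mul0r subr0 => /eqP; rewrite oner_eq0.
Qed.

Lemma prod_form_of_neq0 (s : seq ('I_m * 'I_m * k)) :
  all valid s -> \prod_(t <- s) form_of t != 0.
Proof.
move=> /allP s_valid; rewrite prodf_seq_neq0.
by apply/allP => t /s_valid/form_of_neq0.
Qed.

Lemma restrict_prod_neq0 (t : 'I_m * 'I_m * k) (s : seq ('I_m * 'I_m * k)) :
    valid t -> all valid s -> t \notin s ->
  restrict t (\prod_(u <- s) form_of u) != 0.
Proof.
move=> t_valid /allP s_valid; rewrite rmorph_prod /= prodf_seq_neq0 => tNs.
apply/allP => u us /=; apply: contraNneq tNs.
by move=> /(restrict_form_inj t_valid (s_valid _ us)) ->.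
Qed.

(** The forms are pairwise non-associated primes, so they can be divided out one at a time:
    [restrict t] kills the whole product but none of the other forms. *)
Lemma prod_form_of_divides (s : seq ('I_m * 'I_m * k)) (p : R) :
    all valid s -> uniq s -> (forall t, t \in s -> restrict t p = 0) ->
  exists q, p = q * \prod_(t <- s) form_of t.
Proof.
elim: s p => [|t s IHs] p /=; first by exists p; rewrite big_nil mulr1.
move=> /andP[t_valid s_valid] /andP[tNs s_uniq] p0.
have [u us|q pE] := IHs p s_valid s_uniq; first by rewrite p0 // inE us orbT.
have /eqP := p0 _ (mem_head t s).
rewrite pE rmorphM /= mulf_eq0 (negPf (restrict_prod_neq0 _ _ _)) // orbF.
move=> /eqP/(restrict_eq0P _ t_valid)[r qE]; exists r.
by rewrite qE big_cons mulrA.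
Qed.

(** By Leibniz, modulo one form only the term differentiating that form survives, and the product of
    the other forms is nonzero there. Conversely, the quotients theta(l) / l add up. *)
Lemma derivation_preserves_prod (theta : R -> R) (s : seq ('I_m * 'I_m * k)) :
    is_derivation theta -> all valid s -> uniq s ->
  (exists q, theta (\prod_(t <- s) form_of t) = q * \prod_(t <- s) form_of t)
  <-> (forall t, t \in s -> restrict t (theta (form_of t)) = 0).
Proof.
move=> thetaD s_valid s_uniq; have [_ leibniz] := thetaD; split=> [[q qE] t ts|].
  have t_valid : valid t by apply: (allP s_valid).
  have := congr1 (restrict t) qE.
  rewrite (perm_big _ (perm_to_rem ts)) /= big_cons leibniz rmorphD !rmorphM /=.
  rewrite restrict_form // mul0r addr0 mul0r mulr0 => /eqP.
  rewrite mulf_eq0 => /orP[/eqP //|/eqP r0].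
  suff: restrict t (\prod_(u <- rem t s) form_of u) != 0 by rewrite r0 eqxx.
  apply: restrict_prod_neq0; rewrite ?mem_rem_uniqF //.
  by apply/allP => u /mem_rem/(allP s_valid).
elim: s s_valid {s_uniq} => [|t s IHs] /=.
  by move=> _ _; exists 0; rewrite big_nil derivation1 ?mul0r.
move=> /andP[t_valid s_valid] st; have [|q qE] := IHs s_valid.
  by move=> u us; apply: st; rewrite inE us orbT.
have /(restrict_eq0P _ t_valid)[r rE] := st _ (mem_head t s).
by exists (r + q); rewrite big_cons leibniz qE rE; ring.
Qed.

End LinearForms.

(** * Derivations with prescribed values on the variables *)

Section Derivations.

Variables (k : fieldType) (m : nat).
Local Notation R := {mpoly k[m]}.

Lemma derivation_eq (theta eta : R -> R) :
    is_derivation theta -> is_derivation eta ->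
  (forall i, theta 'X_i = eta 'X_i) -> theta =1 eta.
Proof.
have derC (delta : R -> R) c : is_derivation delta -> delta c%:MP = 0.
  move=> dD; have [lin _] := dD; have := lin c 1 0.
  by rewrite (derivation1 dD) (derivation0 dD) addr0 scaler0 addr0 -alg_mpolyC.
move=> thetaD etaD eqX; elim/mpoly_ring_ind => [c|i|p q pE qE|p q pE qE] //.
- by rewrite !derC.
- have [lint _] := thetaD; have [line _] := etaD.
  by have := lint 1 p q; have := line 1 p q; rewrite !scale1r pE qE => -> ->.
- by have [_ ->] := thetaD; have [_ ->] := etaD; rewrite pE qE.
Qed.

Definition der_of (w : 'I_m -> R) (f : R) : R := \sum_(i < m) w i * f^`M(i).

Lemma der_ofX w i : der_of w 'X_i = w i.
Proof.
rewrite /der_of (bigD1 i) //= big1 ?addr0 => [|j ji]; rewrite mderivX mnm1E.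
  rewrite eqxx scale1r; have -> : (U_(i) - U_(i) = 0)%MM; last first.
    by rewrite mpolyX0 mulr1.
  by apply/mnmP => l; rewrite mnmBE subnn mnm0E.
by rewrite [i == j]eq_sym (negPf ji) scale0r mulr0.
Qed.

Lemma der_of_derivation w : is_derivation (der_of w).
Proof.
split=> [c p q|p q]; rewrite /der_of.
  rewrite scaler_sumr -big_split; apply: eq_bigr => i _ /=.
  by rewrite mderivD mderivZ mulrDr scalerAr.
rewrite mulr_suml mulr_sumr -big_split; apply: eq_bigr => i _ /=.
by rewrite mderivM; ring.
Qed.

Lemma der_of_sum s (c : 'I_s -> R) (w : 'I_s -> 'I_m -> R) f :
  \sum_(j < s) c j * der_of (w j) f
    = der_of (fun i => \sum_(j < s) c j * w j i) f.
Proof.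
rewrite /der_of; under eq_bigr do rewrite mulr_sumr.
rewrite exchange_big; apply: eq_bigr => i _; rewrite mulr_suml.
by apply: eq_bigr => j _; rewrite mulrA.
Qed.

End Derivations.

(** * Homogeneity of products *)

Lemma dhomog_prod_sum (k : fieldType) (m d : nat) (T : Type) (r : seq T)
    (P : pred T) (F : T -> {mpoly k[m]}) :
    (forall i, P i -> F i \is d.-homog) ->
  \prod_(i <- r | P i) F i \is (\sum_(i <- r | P i) d)%N.-homog.
Proof.
move=> Fd; elim/big_rec2: _ => [|i e p Pi pe]; first exact: dhomog1.
by apply: dhomogM; first exact: Fd.
Qed.

Lemma dhomogU (k : fieldType) (m : nat) (i : 'I_m) :
  ('X_i : {mpoly k[m]}) \is 1.-homog.
Proof. by rewrite dhomogX /= mdeg1. Qed.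

(** * The forms of the arrangement and the Newton family *)

Section Hypertetrahedral.

Variables (k : fieldType) (n a : nat) (zs cs : seq k).
Local Notation R := {mpoly k[n.+1]}.
Local Notation I := 'I_n.+1.
Local Notation pen := (inord n.-1 : I).
Local Notation y i := ('X_i ^+ a : R).

Definition last_pair (i j : I) : bool := (i == pen) && (j == ord_max).

(** For i < j, the c such that x_i = c x_j is a hyperplane: [zs] stands for the a-th roots of unity,
    [cs] for the roots of g, which involves the last two variables only. *)
Definition slopes (i j : I) : seq k :=
  zs ++ (if last_pair i j then cs else [::]).

Definition binary_factor : R := \prod_(c <- cs) form_of (pen, ord_max, c).

(** The extra factor sits at s = 1 because the pivot of that vector is its entry n - 1, which has to
    contain the forms of g. *)
Definition newton (s : nat) (i : I) : R :=
  (\prod_(l < n.+1 | (n - s < l)%N) (y i - y l))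
  * (if s == 1%N then binary_factor else 1).

Lemma newton0 i : newton 0 i = 1.
Proof.
rewrite /newton mulr1 big_pred0 // => l.
by rewrite subn0 ltnNge -ltnS ltn_ord.
Qed.

(** The node y_i is then among the nodes of the product; this is the triangularity of the family. *)
Lemma newton_eq0 s (i : I) : (s <= n)%N -> (n < i + s)%N -> newton s i = 0.
Proof.
move=> le_s lt_n; rewrite /newton (bigD1 i) /=; first by rewrite subrr !mul0r.
lia.
Qed.

Lemma newton_homog s i : (s <= n)%N ->
  newton s i \is (if s == 1%N then a + size cs else s * a)%N.-homog.
Proof.
move=> le_s; have homog_prod :
    \prod_(l < n.+1 | (n - s < l)%N) (y i - y l) \is (s * a).-homog.
  have <- : (\sum_(l < n.+1 | (n - s < l)%N) a)%N = (s * a)%N.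
    rewrite -(big_geq_mkord _ _ (fun=> true)) sum_nat_const_nat.
    by congr muln; lia.
  apply: dhomog_prod_sum => l _.
  have ya j : y j \is (a).-homog.
    by have := dhomogMn a (dhomogU k j); rewrite mul1n.
  by rewrite rpredB ?ya.
rewrite /newton; case: eqP => [s1|_]; last by rewrite mulr1.
rewrite s1 mul1n in homog_prod *; apply: dhomogM => //.
have -> : size cs = (\sum_(c <- cs) 1)%N by rewrite sum1_size.
apply: dhomog_prod_sum => c _.
by rewrite rpredB ?dhomogU // dhomogZ ?dhomogU.
Qed.

Hypothesis n_gt1 : (1 < n)%N.
Hypothesis prod_zs : forall x y : {mpoly k[n.+1]},
  \prod_(c <- zs) (x - c *: y) = x ^+ a - y ^+ a.
Hypothesis zs_root : forall c, c \in zs -> c ^+ a = 1.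
Hypothesis uniq_slopes : uniq (0 :: zs ++ cs).

Definition coordinates : seq (I * I * k) := [seq (i, i, 0) | i <- enum I].

Definition pairs : seq (I * I) :=
  [seq p : I * I <- enum {: I * I} | (p.1 < p.2)%N].

Definition diagonals : seq (I * I * k) :=
  [seq (p.1, p.2, c) | p <- pairs, c <- slopes p.1 p.2].

Definition all_forms : seq (I * I * k) := coordinates ++ diagonals.

(** The forms that must divide h_i once h_l = 0 for all l > i. *)
Definition block (i : I) : seq (I * I * k) :=
  [seq (i, l, c) | l <- [seq l : I <- enum I | (i < l)%N], c <- slopes i l].

Lemma pen_val : pen = n.-1 :> nat.
Proof. by rewrite inordK // prednK // ltnW // ltnW. Qed.

Lemma mem_diagonals t :
  (t \in diagonals) = (t.1.1 < t.1.2)%N && (t.2 \in slopes t.1.1 t.1.2).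
Proof.
apply/allpairsPdep/andP => [[p [c [pP cP ->]]] /=|[lt_t ct]].
  by move: pP; rewrite mem_filter => /andP[].
exists t.1, t.2; rewrite mem_filter mem_enum andbT; split => //.
by case: t {lt_t ct} => [[]].
Qed.

Lemma mem_block i t :
  (t \in block i) = [&& t.1.1 == i, (i < t.1.2)%N & t.2 \in slopes i t.1.2].
Proof.
apply/allpairsPdep/and3P => [[l [c [lP cP ->]]] /=|[/eqP eq_i lt_t ct]].
  by move: lP; rewrite mem_filter => /andP[].
exists t.1.2, t.2; rewrite mem_filter mem_enum andbT; split => //.
by rewrite -eq_i; case: t {lt_t ct eq_i} => [[]].
Qed.

Lemma uniq_slopes_pair i j : uniq (slopes i j).
Proof.
move: uniq_slopes; rewrite cons_uniq /slopes => /andP[_].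
by case: ifP => // _; rewrite cats0 cat_uniq => /andP[].
Qed.

Lemma slopes_neq0 i j c : c \in slopes i j -> c != 0.
Proof.
move: uniq_slopes; rewrite cons_uniq => /andP[zcs _] cij.
apply: contraNneq zcs => <-; move: cij; rewrite /slopes !mem_cat.
by case: ifP => _ => [//|]; rewrite in_nil orbF => ->.
Qed.

Lemma valid_diagonal (i j : I) c :
  (i < j)%N -> c \in slopes i j -> valid ((i, j, c) : I * I * k).
Proof.
move=> lt_ij /slopes_neq0 c0; rewrite /valid /= lt_ij c0.
by case: eqP => // eq_ij; rewrite eq_ij ltnn in lt_ij.
Qed.

Lemma all_forms_valid : all (@valid k n.+1) all_forms.
Proof.
apply/allP => t; rewrite mem_cat => /orP[/mapP[i _ ->]|].
  by rewrite /valid /= !eqxx.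
rewrite mem_diagonals; case: t => [[i j] c] /= /andP[lt_ij cP].
exact: valid_diagonal.
Qed.

Lemma block_valid i : all (@valid k n.+1) (block i).
Proof.
apply/allP => -[[s l] c]; rewrite mem_block => /and3P[/= /eqP -> lt_il cP].
exact: valid_diagonal.
Qed.

Lemma all_forms_uniq : uniq all_forms.
Proof.
rewrite cat_uniq map_inj_uniq ?enum_uniq /=; last by move=> i j [].
apply/andP; split.
  apply/hasPn => t; rewrite mem_diagonals => /andP[lt_t _].
  by apply/negP => /mapP[i _ tE]; rewrite tE ltnn in lt_t.
apply: allpairs_uniq_dep => [|p _|].
- by rewrite filter_uniq // enum_uniq.
- exact: uniq_slopes_pair.
- by move=> [[i j] c] [[s t] d] _ _ /= [-> -> ->].
Qed.

Lemma block_uniq i : uniq (block i).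
Proof.
apply: allpairs_uniq_dep => [|l _|].
- by rewrite filter_uniq // enum_uniq.
- exact: uniq_slopes_pair.
- by move=> [j c] [t d] _ _ /= [-> ->].
Qed.

Lemma prod_slopes i j :
  \prod_(c <- slopes i j) form_of (i, j, c)
    = (y i - y j) * (if last_pair i j then binary_factor else 1).
Proof.
rewrite big_cat -prod_zs; congr (_ * _); rewrite /last_pair.
by case: ifP => [/andP[/eqP -> /eqP ->]|_] //; rewrite big_nil.
Qed.

Lemma prod_all_forms :
  \prod_(t <- all_forms) form_of t = hypertetrahedral_eq a binary_factor.
Proof.
rewrite big_cat /hypertetrahedral_eq -mulrA; congr (_ * _).
  rewrite big_map big_enum; apply: eq_bigr => i _.
  by rewrite /form_of scale0r subr0.
rewrite big_allpairs_dep big_filter big_enum_cond /=.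
under eq_bigr do rewrite prod_slopes.
rewrite big_split /= pair_big_dep /=; congr (_ * _).
rewrite (bigD1 (pen, ord_max)) /=; last by rewrite pen_val ltn_predL ltnW.
rewrite /last_pair !eqxx /= big1 ?mulr1 // => -[i j] /= /andP[_].
by rewrite xpair_eqE => /negPf ->.
Qed.

(** The nodes beyond n - s are exactly those beyond i, and s = 1 iff i = n - 1, the one row whose
    slopes include [cs]. *)
Lemma newton_pivot s (i : I) : (i + s)%N = n ->
  newton s i = \prod_(t <- block i) form_of t.
Proof.
move=> isn.
have -> : \prod_(t <- block i) form_of t = \prod_(l < n.+1 | (i < l)%N)
    ((y i - y l) * (if last_pair i l then binary_factor else 1)).
  rewrite big_allpairs_dep big_filter big_enum_cond.
  by apply: eq_bigr => l _; apply: prod_slopes.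
rewrite big_split /newton; congr (_ * _).
  by apply: eq_bigl => l; congr (_ < _)%N; lia.
have s1 : (s == 1%N) = (i == pen) by rewrite -val_eqE /= pen_val; lia.
rewrite s1 /last_pair; case: ifP => [/eqP eq_i|_]; last by rewrite big1.
rewrite (bigD1 ord_max) /= ?eqxx; last by rewrite eq_i pen_val; lia.
by rewrite big1 ?mulr1 // => l /andP[_ /negPf ->].
Qed.

Lemma newton_pivot_neq0 s (i : I) : (i + s)%N = n -> newton s i != 0.
Proof.
by move=> /newton_pivot ->; apply: prod_form_of_neq0 (block_valid i).
Qed.

(* The congruences defining logarithmic derivations: sum_i x_i h_i d_i is
   tangent to the arrangement iff h_i = h_j on each x_i = c x_j. *)
Definition log_weight (h : I -> R) : Prop :=
  forall (i j : I) c, (i < j)%N -> c \in slopes i j ->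
    restrict (i, j, c) (h i) = restrict (i, j, c) (h j).

(** On a slope in [zs] one has y_i = y_j, and up to the common factor g the entry depends on i only
    through y_i. A slope in [cs] concerns entries n - 1 and n only: they are both 1 for s = 0, both
    divisible by g for s = 1, and both 0 for s >= 2. *)
Lemma newton_log s : (s <= n)%N -> log_weight (newton s).
Proof.
move=> le_s i j c lt_ij; rewrite /slopes mem_cat => /orP[czs|].
  have eq_y : restrict (i, j, c) (y i) = restrict (i, j, c) (y j).
    rewrite !rmorphXn /= !restrictX /= eqxx.
    have [eq_ji|_] := eqVneq j i; first by rewrite eq_ji ltnn in lt_ij.
    by rewrite exprZn zs_root // scale1r.
  have eq_prod :
      restrict (i, j, c) (\prod_(l < n.+1 | (n - s < l)%N) (y i - y l))
      = restrict (i, j, c) (\prod_(l < n.+1 | (n - s < l)%N) (y j - y l)).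
    rewrite [LHS]restrict_prod [RHS]restrict_prod.
    by apply: eq_bigr => l _; rewrite 2!restrictB eq_y.
  by rewrite /newton [LHS]restrictM [RHS]restrictM eq_prod.
case: ifP => [/andP[/eqP -> /eqP ->] ccs|_ c_nil]; last first.
  by exfalso; rewrite in_nil in c_nil.
case: s le_s => [|[|s]] le_s; first by rewrite !newton0.
  have g0 : restrict (pen, ord_max, c) binary_factor = 0.
    rewrite /binary_factor (perm_big _ (perm_to_rem ccs)) /= big_cons restrictM.
    rewrite restrict_form ?mul0r // valid_diagonal //.
      by rewrite pen_val /=; lia.
    by rewrite /slopes /last_pair !eqxx mem_cat ccs orbT.
  by rewrite /newton [LHS]restrictM [RHS]restrictM
    [X in _ * X = _]g0 [X in _ = _ * X]g0 [LHS]mulr0 [RHS]mulr0.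
by rewrite !newton_eq0 ?pen_val //=; lia.
Qed.

(** * Newton interpolation and independence *)

Lemma newton_interpolation (h : I -> R) : log_weight h ->
  exists c : nat -> R, forall i, h i = \sum_(s < n.+1) c s * newton s i.
Proof.
move=> h_log.
(* After s steps the expansion is correct at the last s nodes, i > n - s; s = n + 1 covers all of
   them. *)
suff step s : (s <= n.+1)%N -> exists c : nat -> R, forall i : I,
    (n < i + s)%N -> h i = \sum_(j < s) c j * newton j i.
  have [c cE] := step _ (leqnn _); exists c => i; apply: cE; lia.
elim: s => [|s IHs] le_s.
  by exists (fun=> 0) => i; rewrite addn0 ltnNge -ltnS ltn_ord.
have [c cE] := IHs (ltnW le_s).
pose h' i := h i - \sum_(j < s) c j * newton j i.
have h'_log : log_weight h'.
  move=> i j d lt_ij dij.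
  have eq_sum : restrict (i, j, d) (\sum_(l < s) c l * newton l i)
      = restrict (i, j, d) (\sum_(l < s) c l * newton l j).
    rewrite [LHS]restrict_sum [RHS]restrict_sum; apply: eq_bigr => l _.
    rewrite [LHS]restrictM [RHS]restrictM (newton_log _ lt_ij dij) //.
    have := ltn_ord l; lia.
  by rewrite /h' [LHS]restrictB [RHS]restrictB (h_log _ _ _ lt_ij dij)
    [X in _ - X = _]eq_sum.
pose i0 : I := inord (n - s).
have i0E : (i0 + s)%N = n by rewrite inordK; lia.
(* The remainder [h'] vanishes at every l > i0, so its congruences force [h' i0] to vanish on all
   hyperplanes of [block i0]; the quotient by the pivot is the next coefficient. *)
have [t|q qE] :=
    @prod_form_of_divides _ _ _ (h' i0) (block_valid i0) (block_uniq i0).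
  rewrite mem_block; case: t => [[i l] d] /and3P[/= /eqP -> lt_l dP].
  rewrite h'_log // /h' -cE ?subrr ?raddf0 //; lia.
exists (fun j => if j == s then q else c j) => i lt_n.
rewrite big_ord_recr /= eqxx.
have sE : \sum_(j < s) (if (j : nat) == s then q else c j) * newton j i
    = \sum_(j < s) c j * newton j i.
  by apply: eq_bigr => j _; rewrite ltn_eqF.
rewrite sE; have [lt_is|le_is] := ltnP n (i + s).
  by rewrite cE // newton_eq0 ?mulr0 ?addr0.
have -> : i = i0 by apply: ord_inj; lia.
by rewrite newton_pivot // -qE /h' addrC subrK.
Qed.

(** At node n - s, terms of smaller index vanish by induction and those of larger index by
    triangularity, leaving [c s] times a nonzero pivot. *)
Lemma newton_free (c : I -> R) :
  (forall i, \sum_(s < n.+1) c s * newton s i = 0) -> forall s, c s = 0.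
Proof.
move=> c0 s; elim/ltn_ind: {s}(s : nat) {-2}s (erefl (s : nat)) => e IHe s sE.
pose i0 : I := inord (n - s).
have i0E : (i0 + s)%N = n by have := ltn_ord s; rewrite inordK; lia.
have := c0 i0; rewrite (bigD1 s) //= big1 ?addr0 => [/eqP|j ne_js].
  by rewrite mulf_eq0 (negPf (newton_pivot_neq0 i0E)) orbF => /eqP.
have [lt_js|le_sj] := ltnP j s; first by rewrite (IHe j) ?mul0r // -sE.
have lt_n : (n < i0 + j)%N.
  move: ne_js; rewrite -val_eqE /= => ne_js.
  lia.
by rewrite newton_eq0 ?mulr0 // -ltnS.
Qed.

(** * The Newton derivations as a basis *)

Definition newton_der (s : nat) : R -> R := der_of (fun i => 'X_i * newton s i).

(** The coordinate hyperplanes give theta x_i = x_i h_i. On x_i = c x_j, theta (x_i - c x_j) then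
    becomes c x_j (h_i - h_j), where c x_j cancels. *)
Lemma log_all_forms (theta : R -> R) : is_derivation theta ->
  (forall t, t \in all_forms -> restrict t (theta (form_of t)) = 0) <->
  exists2 h, forall i, theta 'X_i = 'X_i * h i & log_weight h.
Proof.
move=> thetaD; have [lin_theta _] := thetaD.
have theta_form t : theta (form_of t) = theta 'X_t.1.1 - t.2 *: theta 'X_t.1.2.
  rewrite /form_of addrC -scaleNr lin_theta addrC.
  by rewrite scaleNr.
have restr_form (i j : I) c (h : I -> R) : (i < j)%N ->
    theta 'X_i = 'X_i * h i -> theta 'X_j = 'X_j * h j ->
    restrict (i, j, c) (theta (form_of (i, j, c))) =
      c *: 'X_j * (restrict (i, j, c) (h i) - restrict (i, j, c) (h j)).
  move=> lt_ij hi hj; rewrite theta_form hi hj restrictB restrictZ !restrictM.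
  rewrite !restrictX /= eqxx; case: eqP => [eq_ji|_].
    by rewrite eq_ji ltnn in lt_ij.
  by rewrite mulrBr !scalerAl.
split=> [tP|[h hE h_log] t].
  have /fin_all_exists[h hE] : forall i : I, exists hi, theta 'X_i = 'X_i * hi.
    move=> i; have coord_i : (i, i, 0) \in all_forms.
      by rewrite mem_cat map_f ?mem_enum.
    have /(restrict_eq0P _ (allP all_forms_valid _ coord_i))[q] := tP _ coord_i.
    rewrite theta_form /= scale0r subr0 /form_of /= scale0r subr0 mulrC => qE.
    by exists q.
  exists h => // i j c lt_ij cP.
  have := tP (i, j, c); rewrite mem_cat mem_diagonals lt_ij cP orbT => /(_ isT).
  rewrite (restr_form _ _ _ h) // => /eqP; rewrite mulf_eq0.
  rewrite scaler_eq0 (negPf (slopes_neq0 cP)) -msize_poly_eq0 mmeasureX.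
  by rewrite subr_eq0 => /eqP.
rewrite mem_cat => /orP[/mapP[i _ ->]|].
  rewrite theta_form /= scale0r subr0 hE restrictM restrictX eqxx.
  by rewrite scale0r mul0r.
rewrite mem_diagonals; case: t => [[i j] c] /= /andP[lt_ij cP].
by rewrite (restr_form _ _ _ h) // h_log // subrr mulr0.
Qed.

(** The scalar [b], to become the leading coefficient of g, is a unit and does not affect
    divisibility. *)
Lemma der_logP (A : arrangement k n.+1) (b : k) (theta : R -> R) : b != 0 ->
    defining_equation A = b *: \prod_(t <- all_forms) form_of t ->
  der_log A theta <-> is_derivation theta /\
    exists2 h, forall i, theta 'X_i = 'X_i * h i & log_weight h.
Proof.
move=> b0 AE.
suff eqv : is_derivation theta ->
    (exists q, theta (defining_equation A) = q * defining_equation A) <->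
    exists2 h, forall i, theta 'X_i = 'X_i * h i & log_weight h.
  by split=> -[thetaD]; move/(eqv thetaD).
move=> thetaD.
rewrite -(log_all_forms thetaD).
rewrite -(derivation_preserves_prod thetaD all_forms_valid all_forms_uniq) AE.
have -> : theta (b *: \prod_(t <- all_forms) form_of t)
    = b *: theta (\prod_(t <- all_forms) form_of t).
  have [lin _] := thetaD; have := lin b (\prod_(t <- all_forms) form_of t) 0.
  by rewrite (derivation0 thetaD) !addr0.
by split=> -[q qE]; exists q; [apply: (scalerI b0); rewrite qE | rewrite qE];
   rewrite scalerAr.
Qed.

Lemma newton_der_basis (A : arrangement k n.+1) (b : k) : b != 0 ->
    defining_equation A = b *: \prod_(t <- all_forms) form_of t ->
  der_log_basis A (fun s : I => newton_der s).
Proof.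
move=> b0 AE; have logP := der_logP _ b0 AE; split=> [s|eta|c c0].
- apply/logP; split; first exact: der_of_derivation.
  exists (newton s) => [i|]; first by rewrite /newton_der der_ofX.
  by apply: newton_log; rewrite // -ltnS.
- move=> /logP[etaD [h hE /newton_interpolation[c cE]]].
  exists (fun s => c s) => f; rewrite der_of_sum; move: f.
  apply: derivation_eq etaD (der_of_derivation _) _ => i.
  rewrite der_ofX hE cE mulr_sumr; apply: eq_bigr => s _; ring.
- apply: newton_free => i; have := c0 'X_i; rewrite der_of_sum der_ofX.
  under eq_bigr do rewrite mulrCA.
  rewrite -mulr_sumr => /eqP.
  by rewrite mulf_eq0 -msize_poly_eq0 mmeasureX => /eqP.
Qed.

Lemma arrangement_all_forms (b : k) : b != 0 ->
  exists A : arrangement k n.+1,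
    defining_equation A = b *: \prod_(t <- all_forms) form_of t.
Proof.
move=> b0; pose t0 : I * I * k := (ord0, ord0, 0).
(* A defining equation is a bare product of forms, so the form x_0 absorbs the scalar [b]. *)
pose scal t := if t == t0 then b else 1.
have scal0 t : scal t != 0 by rewrite /scal; case: ifP => _; rewrite ?oner_neq0.
pose s := [seq scal t *: form_of t | t <- all_forms].
have s_linear l : l \in s -> l != 0 /\ l \is 1.-homog.
  move=> /mapP[t /(allP all_forms_valid) t_valid ->]; split.
    by rewrite scaler_eq0 negb_or scal0 form_of_neq0.
  by rewrite dhomogZ // rpredB ?dhomogU // dhomogZ ?dhomogU.
have s_nonprop (i j : nat) : (i < j < size s)%N ->
    forall c : k, s`_i != c *: s`_j.
  rewrite size_map => /andP[lt_ij lt_j] c; have lt_i := ltn_trans lt_ij lt_j.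
  have valid_nth l : (l < size all_forms)%N -> valid (nth t0 all_forms l).
    by move=> lt_l; apply: (allP all_forms_valid); apply: mem_nth.
  rewrite !(nth_map t0) //; apply/eqP => eq_ij.
  (* On the hyperplane of the later form the right side vanishes, hence so does the earlier form;
     the two triples would coincide. *)
  have := congr1 (restrict (nth t0 all_forms j)) eq_ij.
  rewrite !restrictZ restrict_form ?valid_nth // !scaler0 => /eqP.
  rewrite scaler_eq0 (negPf (scal0 _)) => /eqP.
  move=> /(restrict_form_inj (valid_nth _ lt_j) (valid_nth _ lt_i))/eqP.
  by rewrite nth_uniq ?all_forms_uniq // gtn_eqF.
exists (Arrangement s_linear s_nonprop).
rewrite /defining_equation big_map scaler_prod; congr (_ *: _).
have t0P : t0 \in all_forms by rewrite mem_cat map_f ?mem_enum.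
rewrite (bigD1_seq t0) ?all_forms_uniq //= {1}/scal eqxx big1 ?mulr1 // => t.
by rewrite /scal => /negPf ->.
Qed.

End Hypertetrahedral.

(** * From general coefficients to the basis and its exponents *)

Theorem proposition4p7 (k : closedFieldType) (n a r : nat)
    (hk : [pchar k] =i pred0)
    (hn : (2 <= n)%N) (ha : (2 <= a)%N) (hr : (1 <= r)%N) :
  for_general (fun v : 'I_((r - 1) * a).+1 -> k =>
    exists A : arrangement k n.+1,
      [/\ defining_equation A = hypertetrahedral_eq a (binary_form n v),
          is_free A
        & has_exponents A
            (1 :: rcons [seq i * a + 1 | i <- iota 2 n.-1] (r * a + 1))%N]).
Proof.
have [U [U_open U_nonempty UP]] := for_general_splits ((r - 1) * a) hk (ltnW ha).
exists U; split=> // v /UP[zs [cs [v0 [sz_zs zsE] sz_cs vE uniq_s]]].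
have prod_zs (x y : {mpoly k[n.+1]}) :
    \prod_(c <- zs) (x - c *: y) = x ^+ a - y ^+ a.
  rewrite -homogenize_prod_XsubC -zsE sz_zs.
  (* Only the coefficients of T^a - 1 at a and at 0 survive. *)
  under eq_bigr do rewrite coefB coefXn coef1 scalerBl.
  rewrite sumrB; congr (_ - _).
    rewrite (bigD1 ord_max) //= eqxx scale1r subnn mulr1 big1 ?addr0 // => i.
    by rewrite -val_eqE /= => /negPf ->; rewrite scale0r.
  rewrite (bigD1 ord0) //= scale1r subn0 mul1r big1 ?addr0 // => i.
  by rewrite -val_eqE /= => /negPf ->; rewrite scale0r.
have zs_root c : c \in zs -> c ^+ a = 1.
  rewrite -root_prod_XsubC -zsE /root !hornerE subr_eq0.
  by move=> /eqP.
have [A AE] := arrangement_all_forms n uniq_s v0.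
have basis := newton_der_basis hn prod_zs zs_root uniq_s v0 AE.
exists A; split.
- rewrite AE (prod_all_forms cs hn prod_zs) (binary_form_prod _ sz_cs vE).
  by rewrite /hypertetrahedral_eq scalerAr.
- by exists (fun s : 'I_n.+1 => newton_der a cs s).
(* One more than the degree of [newton s], because of the factor x_i; s = 0 gives the exponent 1 of
   the Euler derivation. *)
pose deg (s : nat) := (if s == 1 then r * a + 1 else s * a + 1)%N.
exists (fun s : 'I_n.+1 => newton_der a cs s), (fun s : 'I_n.+1 => deg s); split=> //.
- by move=> f; apply: eq_bigr => i _; rewrite newton0 mulr1.
- move=> s i; rewrite /newton_der der_ofX.
  have := dhomogM (dhomogU k i) (newton_homog a cs i (ltn_ord s)).
  congr (_ \is _.-homog); rewrite /deg; case: ifP => _; last by rewrite addnC.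
  (* Here a + (r - 1) a = r a, where r >= 1 makes the truncated subtraction exact. *)
  by rewrite sz_cs; nia.
rewrite (map_comp deg val) val_enum_ord.
have -> : [seq deg s | s <- iota 0 n.+1] =
    (1 :: r * a + 1 :: [seq i * a + 1 | i <- iota 2 n.-1])%N.
  have -> : n.+1 = (2 + n.-1)%N by lia.
  rewrite iotaD map_cat; congr [:: _, _ & _].
  apply/eq_in_map => i; rewrite mem_iota /deg => /andP[i_gt1 _].
  by rewrite gtn_eqF.
by rewrite perm_cons perm_sym perm_rcons.
Qed.
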